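(* Let $(\alpha_0,\beta_0)\in\mathbb{R}^2$ have an eventually periodic Jacobi multidimensional continued fraction $$(\alpha_0,\beta_0)=[(a_0,\ldots,a_{k-1},\overline{a_k,\ldots,a_{k+h-1}}),(b_0,\ldots,b_{k-1},\overline{b_k,\ldots,b_{k+h-1}})],$$ i.e. $a_{n+h}=a_n$ and $b_{n+h}=b_n$ for all $n\ge k$, where $k\ge 0$ and $h\ge 1$. Then $\alpha_0$ and $\beta_0$ are cubic irrationals. Moreover, if $0<\alpha_0<1$ and $0<\beta_0<1$, then $$H(\alpha_0)\leq 3024\, C_{h+k-1}^9,\qquad H(\beta_0)\leq 3024\, C_{h+k-1}^9 .$$
   Context: Jacobi's algorithm applied to $(\alpha_0,\beta_0)\in\mathbb{R}^2$ produces, for $n\ge 0$, $a_n=\lfloor\alpha_n\rfloor$, $b_n=\lfloor\beta_n\rfloor$, $\alpha_{n+1}=\frac{1}{\beta_n-b_n}$, $\beta_{n+1}=\frac{\alpha_n-a_n}{\beta_n-b_n}$. If no $\beta_n$ is an integer, two infinite integer sequences are obtained and one writes $(\alpha_0,\beta_0)=[(a_0,a_1,\ldots),(b_0,b_1,\ldots)]$, the (infinite) multidimensional continued fraction (MCF) of $(\alpha_0,\beta_0)$. The overline denotes infinite periodic repetition. The denominators of the convergents are defined by $C_{-3}=1$, $C_{-2}=C_{-1}=0$ and $C_n=a_nC_{n-1}+b_nC_{n-2}+C_{n-3}$ for $n\ge 0$. For an algebraic number $\gamma$, let $P_\gamma$ be its minimal polynomial over $\mathbb{Z}$ (integer coefficients,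 vanishing at $\gamma$, irreducible over $\mathbb{Z}$, in particular primitive). The naive height $H(\gamma)$ is the maximum of the absolute values of the coefficients of $P_\gamma$. A cubic irrational is a real algebraic number of degree $3$ over $\mathbb{Q}$. *)

(* Defs.v *)
From HB Require Import structures.
From mathcomp Require Import all_boot all_order all_algebra.
From mathcomp Require Import all_classical all_reals.

Set Implicit Arguments.
Unset Strict Implicit.
Unset Printing Implicit Defensive.

Import Order.TTheory GRing.Theory Num.Theory.
Local Open Scope ring_scope.

(* Since [0^-1 = 0], this is total; it is the step of Jacobi's algorithm only
   when [x.2] is not an integer, which [is_mcf] demands along the orbit. *)
Definition jacobi_step (R : realType) (x : R * R) : R * R :=
  let f := x.2 - (Num.floor x.2)%:~R in
  (f^-1, (x.1 - (Num.floor x.1)%:~R) / f).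

Definition jacobi (R : realType) (alpha0 beta0 : R) (n : nat) : R * R :=
  iter n (@jacobi_step R) (alpha0, beta0).

Definition is_mcf (R : realType) (alpha0 beta0 : R) (a b : nat -> int) : Prop :=
  [/\ forall n, (jacobi alpha0 beta0 n).2 \isn't a Num.int,
      forall n, a n = Num.floor (jacobi alpha0 beta0 n).1 &
      forall n, b n = Num.floor (jacobi alpha0 beta0 n).2].

(* The index is shifted by 3: [mcf_den3 a b m] is C_(m-3). *)
Fixpoint mcf_den3 (a b : nat -> int) (m : nat) : int :=
  match m with
  | 0 => 1
  | 1 | 2 => 0
  | ((n.+1 as n1).+1 as n2).+1 =>
      a n * mcf_den3 a b n2 + b n * mcf_den3 a b n1 + mcf_den3 a b n
  end.

Definition mcf_den (a b : nat -> int) (n : nat) : int := mcf_den3 a b n.+3.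

Definition cubic_irrational (R : realType) (x : R) : Prop :=
  exists p : {poly rat},
    [/\ p \is monic, irreducible_poly p, root (map_poly ratr p) x
      & size p = 4%N].

(* [irreducible_poly] over [int] refers to pseudo-division and hence ignores
   constant factors; ring-theoretic irreducibility also forces primitivity. *)
Definition irreducible_elt (D : idomainType) (p : D) : Prop :=
  [/\ p != 0, p \isn't a GRing.unit &
      forall q r : D, p = q * r -> q \is a GRing.unit \/ r \is a GRing.unit].

Definition is_minpolyZ (R : realType) (x : R) (P : {poly int}) : Prop :=
  irreducible_elt P /\ root (map_poly intr P) x.

(* The minimal polynomial over the integers is unique only up to sign, which
   does not affect the height. It is 0 by convention if x is transcendental. *)
Definition minpolyZ (R : realType) (x : R) : {poly int} :=
  xget 0 [set P : {poly int} | is_minpolyZ x P]%classic.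

Definition naive_height (R : realType) (x : R) : nat :=
  \max_(i < size (minpolyZ x)) absz ((minpolyZ x)`_i)%R.

(* Main.v *)
Require Import Defs.
From HB Require Import structures.
From mathcomp Require Import all_boot all_order all_algebra.
From mathcomp Require Import all_classical all_reals.
From mathcomp Require Import ring lra zify.
From mathcomp Require qpoly.

Set Implicit Arguments.
Unset Strict Implicit.
Unset Printing Implicit Defensive.

Import Order.TTheory GRing.Theory Num.Theory.
Local Open Scope ring_scope.

(* Along the orbit, a linear form p x + q y + r becomes a sequence e_n obeying the
   recurrence of the convergents. If the form vanishes, then also
   e_n = - u e_(n-1) - v e_(n-2) with 0 <= u < 1 and 0 < v < 1, and the two
   relations force |e_n| < max (|e_(n-1)|, |e_(n-2)|, |e_(n-3)|). For integer
   coefficients this descent shows that 1, x, y are linearly independent over the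
   rationals; for real ones e_n is bounded while the denominators C_n tend to
   infinity, so that the digits determine (x, y), and periodic digits give a
   periodic orbit. Hence (x, y, 1) is an eigenvector of the integer matrix
   N = Y X^-1, where X and Y are the unimodular matrices of convergents at the two
   ends of a period. By independence N has no rational eigenvalue, so that w, w N,
   w N^2 are linearly independent for every rational w <> 0. For w = (1, 0, -t)
   their determinant is a cubic in t over the integers which vanishes at x and has
   no rational root; its coefficients are cubic in the entries of N, which are at
   most 3 C^3. *)

(** * Digits and linear forms along the orbit *)

(** The values [e 0], [e 1], [e 2] are the coefficients of 1, y and x in a linear form; indices are
    shifted as in [mcf_den3]. *)
Definition digit_rec (S : pzRingType) (a b : nat -> int) (e : nat -> S) : Prop :=
  forall n, e n.+3 = (a n)%:~R * e n.+2 + (b n)%:~R * e n.+1 + e n.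

#[local] Arguments jacobi : simpl never.

Lemma jacobiS (R : realType) (x y : R) n :
  jacobi x y n.+1 = jacobi_step (jacobi x y n).
Proof. by []. Qed.

Lemma jacobiD (R : realType) (x y : R) m n :
  jacobi x y (m + n) = jacobi (jacobi x y n).1 (jacobi x y n).2 m.
Proof. by rewrite /jacobi iterD -surjective_pairing. Qed.

Lemma is_mcf_shift (R : realType) (x y : R) a b m : is_mcf x y a b ->
  is_mcf (jacobi x y m).1 (jacobi x y m).2
    (fun n => a (n + m)%N) (fun n => b (n + m)%N).
Proof.
by case=> Hn Ha Hb; split=> n; rewrite -jacobiD //.
Qed.

Lemma frac_itv (R : realType) (x : R) :
  0 <= x - (Num.floor x)%:~R < 1.
Proof.
have := floor_itv x; rewrite intrD; set f := (Num.floor x)%:~R; move: f => f; lra.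
Qed.

Lemma frac_gt0 (R : realType) (x : R) : x \isn't a Num.int ->
  0 < x - (Num.floor x)%:~R.
Proof.
move=> xN; have /andP[f0 _] := frac_itv x; rewrite lt_def f0 andbT subr_eq0.
by apply: contra xN => /eqP ->; rewrite intr_int.
Qed.

Lemma jacobi_next (R : realType) (x y : R) a b n : is_mcf x y a b ->
  [/\ 1 < (jacobi x y n.+1).1,
      0 <= (jacobi x y n.+1).2 < (jacobi x y n.+1).1,
      (jacobi x y n).1 * (jacobi x y n.+1).1 =
        (a n)%:~R * (jacobi x y n.+1).1 + (jacobi x y n.+1).2 &
      (jacobi x y n).2 * (jacobi x y n.+1).1 =
        (b n)%:~R * (jacobi x y n.+1).1 + 1].
Proof.
case=> Hn Ha Hb; rewrite jacobiS; move: (Hn n) (Ha n) (Hb n).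
case: (jacobi x y n) => u v /= vN -> ->.
have f0 := frac_gt0 vN; have /andP[_ f1] := frac_itv v; have gi := frac_itv u.
set f := v - _ in f0 f1 *; set g := u - _ in gi *.
have -> : (Num.floor v)%:~R = v - f by rewrite /f; ring.
have -> : (Num.floor u)%:~R = u - g by rewrite /g; ring.
have fi0 : 0 < f^-1 by rewrite invr_gt0.
have fi1 : 1 < f^-1 by rewrite invf_gt1.
have fK : f * f^-1 = 1 by rewrite divff // gt_eqF.
split=> //; try (by nra); move: fK; generalize f^-1 => i fK; nra.
Qed.

(** The last two claims rest on beta_(n+1) < alpha_(n+1): if the integer parts agree, comparing the
    fractional parts 1 / alpha_(n+2) and beta_(n+2) / alpha_(n+2) gives beta_(n+2) > 1. *)
Lemma digits_ge (R : realType) (x y : R) a b n : is_mcf x y a b ->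
  [/\ 1 <= a n.+1, 0 <= b n.+1, b n.+1 <= a n.+1 &
      a n.+1 = b n.+1 -> 1 <= b n.+2].
Proof.
move=> H; have [_ Ha Hb] := H.
have [u1g v1i _ _] := jacobi_next n H; have [u2g v2i] := jacobi_next n.+1 H.
move: (Ha n.+1) (Hb n.+1) (Hb n.+2) u1g v1i u2g v2i.
move: (jacobi x y n.+1) (jacobi x y n.+2) => [u1 v1] [u2 v2] /= Ea Eb Eb2.
move=> u1g /andP[v1g v1u] u2g _ Eu Ev.
have a1 : 1 <= a n.+1 by rewrite Ea floor_ge_int ltW.
have b0 : 0 <= b n.+1 by rewrite Eb floor_ge_int.
have ba : b n.+1 <= a n.+1 by rewrite Ea Eb le_floor // ltW.
split=> // eab; rewrite Eb2 floor_ge_int; rewrite eab in Eu.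
have : 0 < (u1 - v1) * u2 by apply: mulr_gt0; lra.
by rewrite mulrBl Eu Ev => ?; lra.
Qed.

(* Telescoping alpha_n = a_n + beta_(n+1) / alpha_(n+1) and
   beta_n = b_n + 1 / alpha_(n+1) in a linear form with coefficients e. *)
Lemma jacobi_form (R : realType) (x y : R) a b (e : nat -> R) n :
  is_mcf x y a b -> digit_rec a b e ->
  (\prod_(i < n) (jacobi x y i.+1).1) * (e 2%N * x + e 1%N * y + e 0%N) =
  e n.+2 * (jacobi x y n).1 + e n.+1 * (jacobi x y n).2 + e n.
Proof.
move=> H He; elim: n => [|n IHn]; first by rewrite big_ord0 mul1r.
rewrite big_ord_recr mulrAC IHn {IHn} He.
have [_ _ Eu Ev] := jacobi_next n H.
by rewrite !mulrDl -!mulrA Eu Ev; ring.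
Qed.

(* If p and q have opposite signs, |t| is at most the larger of the two; if they
   have the same sign, then t has the other one, and the first relation expresses
   |s| as a |p| + b |q| + |t|. *)
Lemma form_contract (R : realFieldType) (a b u v p q s t E : R) :
  1 <= a -> 0 <= b -> 0 <= u < 1 -> 0 < v < 1 ->
  t = a * p + b * q + s -> t = - (u * p) - v * q ->
  0 < E -> `|p| <= E -> `|q| <= E -> `|s| <= E -> `|t| < E.
Proof.
move=> a1 b0 /andP[u0 u1] /andP[v0 v1] E1 E2 E0.
rewrite !ler_norml ltr_norml => /andP[p1 p2] /andP[q1 q2] /andP[s1 s2].
have [p0|p0] := lerP 0 p; have [q0|q0] := lerP 0 q; apply/andP; split.
all: nra.
Qed.

Lemma form_lt (R : realType) (x y : R) a b (e : nat -> R) n (E : R) :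
  is_mcf x y a b -> digit_rec a b e -> e 2%N * x + e 1%N * y + e 0%N = 0 ->
  0 < E -> `|e n.+1| <= E -> `|e n.+2| <= E -> `|e n.+3| <= E ->
  `|e n.+4| < E.
Proof.
move=> H He e0 E0 E1 E2 E3.
have [a1 b0 _ _] := digits_ge n H.
have [u1 /andP[v0 vu] _ _] := jacobi_next n.+1 H.
have := jacobi_form n.+2 H He; rewrite e0 mulr0.
move: (jacobi x y n.+2) u1 v0 vu => [u v] /= u1 v0 vu F.
have u0 : 0 < u by apply: lt_trans u1.
have uV : 0 < u^-1 by rewrite invr_gt0.
(* The second relation is the vanishing form at step n + 2, divided by alpha_(n+2). *)
apply: (@form_contract R (a n.+1)%:~R (b n.+1)%:~R (v / u) u^-1
          (e n.+3) (e n.+2) (e n.+1)) => //.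
- by rewrite ler1z.
- by rewrite ler0z.
- by rewrite divr_ge0 ?(ltW u0) //= ltr_pdivrMr // mul1r.
- by rewrite uV invf_lt1.
- have -> : e n.+4 = (e n.+4 * u + e n.+3 * v + e n.+2) / u
      - (v / u * e n.+3) - u^-1 * e n.+2 by field; rewrite gt_eqF.
  by rewrite -F mul0r sub0r.
Qed.

Lemma form_bounded (R : realType) (x y : R) a b (e : nat -> R) :
  is_mcf x y a b -> digit_rec a b e -> e 2%N * x + e 1%N * y + e 0%N = 0 ->
  exists2 E : R, 0 < E & forall n, `|e n| <= E.
Proof.
(* The digit a_0 may be negative, so the contraction starts only with [e 4]; the first four values
   enter the bound directly. *)
move=> H He e0; pose E := 1 + `|e 0%N| + `|e 1%N| + `|e 2%N| + `|e 3%N|.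
have N i : 0 <= `|e i| := normr_ge0 _.
have := N 0; have := N 1; have := N 2; have := N 3 => h3 h2 h1 h0.
have E0 : 0 < E by rewrite /E; lra.
exists E => //.
suff S n : [/\ `|e n.+1| <= E, `|e n.+2| <= E & `|e n.+3| <= E].
  by case=> [|n]; [rewrite /E; lra | have [] := S n].
elim: n => [|n [E1 E2 E3]]; first by rewrite /E; split; lra.
by split=> //; apply/ltW/(form_lt H).
Qed.

(** * Convergents, linear independence and uniqueness of the expansion *)

(** The starts (1, 0, 0), (0, 1, 0), (0, 0, 1) give the two numerators A, B and the common
    denominator C of the convergents. *)
Fixpoint mcf_seq (a b : nat -> int) (x y z : int) (m : nat) : int :=
  match m with
  | 0 => z
  | 1 => y
  | 2 => x
  | ((n.+1 as n1).+1 as n2).+1 =>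
      a n * mcf_seq a b x y z n2 + b n * mcf_seq a b x y z n1 + mcf_seq a b x y z n
  end.

#[local] Arguments mcf_seq : simpl never.

Lemma mcf_seqS a b x y z n : mcf_seq a b x y z n.+3 =
  a n * mcf_seq a b x y z n.+2 + b n * mcf_seq a b x y z n.+1
    + mcf_seq a b x y z n.
Proof. by []. Qed.

Lemma mcf_seq_rec (S : pzRingType) a b x y z :
  digit_rec a b (fun n => (mcf_seq a b x y z n)%:~R : S).
Proof. by move=> n; rewrite mcf_seqS !intrD !intrM. Qed.

Lemma mcf_den3E a b : mcf_den3 a b =1 mcf_seq a b 0 0 1.
Proof.
suff S n : [/\ mcf_den3 a b n = mcf_seq a b 0 0 1 n,
    mcf_den3 a b n.+1 = mcf_seq a b 0 0 1 n.+1
    & mcf_den3 a b n.+2 = mcf_seq a b 0 0 1 n.+2] by move=> n; case: (S n).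
elim: n => // n [E1 E2 E3]; split=> //.
by rewrite mcf_seqS -E1 -E2 -E3.
Qed.

(** The term three places back has coefficient 1, so the recurrence also runs backwards. *)
Lemma mcf_seq_eq0 a b x y z n :
  mcf_seq a b x y z n = 0 -> mcf_seq a b x y z n.+1 = 0 ->
  mcf_seq a b x y z n.+2 = 0 -> [/\ x = 0, y = 0 & z = 0].
Proof.
elim: n => [|n IHn] //; rewrite mcf_seqS => e1 e2.
by rewrite e1 e2 !mulr0 !add0r => e0; apply: IHn.
Qed.

(* The maximum of three consecutive values of a vanishing integer form decreases
   strictly every third step, so the form itself is zero. *)
Lemma mcf_lin_indep (R : realType) (x y : R) a b (p q r : int) :
  is_mcf x y a b -> p%:~R * x + q%:~R * y + r%:~R = 0 ->
  [/\ p = 0, q = 0 & r = 0].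
Proof.
move=> H F; set f := mcf_seq a b p q r.
have step n E : 0 < E -> `|f n.+1| <= E -> `|f n.+2| <= E -> `|f n.+3| <= E ->
    `|f n.+4| < E.
  move=> E0 E1 E2 E3; rewrite -(ltr_int R) intr_norm.
  by apply: (form_lt H (mcf_seq_rec R a b p q r)) => //;
    rewrite -?intr_norm ?ler_int ?ltr0z.
have desc (E : nat) n : `|f n.+1| <= E%:Z -> `|f n.+2| <= E%:Z ->
    `|f n.+3| <= E%:Z -> exists m, [/\ f m = 0, f m.+1 = 0 & f m.+2 = 0].
  elim: E n => [|E IHE] n.
    by rewrite !normr_le0 => /eqP e1 /eqP e2 /eqP e3; exists n.+1.
  move=> E1 E2 E3; have E0 : 0 < E.+1%:Z by [].
  have E4 := step _ _ E0 E1 E2 E3.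
  have E5 := step _ _ E0 E2 E3 (ltW E4).
  have E6 := step _ _ E0 E3 (ltW E4) (ltW E5).
  by apply: (IHE n.+3); lia.
case: (desc (`|f 1%N| + `|f 2%N| + `|f 3%N|)%N 0%N); try by lia.
move=> m [e0 e1 e2].
exact: mcf_seq_eq0 e0 e1 e2.
Qed.

(** Since a >= 1 and b >= 0 from index 1 on, each step adds at least the value three places back;
    the guard 0 < n excludes C_(-1) = 0. *)
Lemma mcf_seq_den_ge (R : realType) (x y : R) a b n : is_mcf x y a b ->
  let C := mcf_seq a b 0 0 1 in
  [/\ [/\ 0 <= C n.+1, 0 <= C n.+2 & 1 <= C n.+3], (0 < n)%N -> 1 <= C n.+2,
      C n.+3 <= C n.+4 & n%:Z <= C n.+4].
Proof.
move=> H C; elim: n => [|n [[C1 C2 C3] C2' C4 Cn]].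
  by have [a1 b1 _ _] := digits_ge 0 H; rewrite /C /mcf_seq; split; [split|..]; lia.
have [a1 b1 _ _] := digits_ge n.+1 H.
have E5 : C n.+4 + C n.+2 <= C n.+1.+4.
  have -> : C n.+1.+4 = a n.+2 * C n.+4 + b n.+2 * C n.+3 + C n.+2 by [].
  by rewrite lerD2r; nia.
split; first (by split; lia); [by move=> _; lia | lia |].
by case: (posnP n) => [n0|/C2' C2'']; lia.
Qed.

(** Applied to the denominators, [jacobi_form] shows that the product of the alpha_i is at least n
    alpha_(n+2); applied to e, it bounds this product times |d| by 3 E alpha_(n+2). Hence n |d| <= 3
    E for all n. *)
Lemma form_bounded_eq0 (R : realType) (x y : R) a b (e : nat -> R) (E : R) :
  is_mcf x y a b -> digit_rec a b e -> (forall n, `|e n| <= E) ->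
  e 2%N * x + e 1%N * y + e 0%N = 0.
Proof.
move=> H He eE; set d := _ + e 0.
have bnd n : n%:R * `|d| <= 3 * E.
  have [u1 /andP[v0 vu] _ _] := jacobi_next n.+1 H.
  have := jacobi_form n.+2 H He.
  have := jacobi_form n.+2 H (mcf_seq_rec R a b 0 0 1).
  have [[_ C2 C3] _ _ C4] := mcf_seq_den_ge n H.
  rewrite -/d [mcf_seq _ _ _ _ _ 2]/0 [mcf_seq _ _ _ _ _ 1]/0.
  rewrite [mcf_seq _ _ _ _ _ 0]/1 !mul0r !add0r mulr1 => -> /(congr1 Num.norm).
  move: (jacobi x y n.+2) u1 v0 vu => [u v] /= u1 v0 vu.
  rewrite normrM ger0_norm; last first.
    rewrite !addr_ge0 ?mulr_ge0 ?ler0z //; lia || lra.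
  have u0 : 0 < u by apply: lt_trans u1.
  move=> F; rewrite -(ler_pM2r u0).
  have {F} : (n%:R * u) * `|d| <= `|e n.+4 * u + e n.+3 * v + e n.+2|.
    rewrite -F ler_wpM2r //.
    apply: (@le_trans _ _ ((mcf_seq a b 0 0 1 n.+4)%:~R * u)).
      by rewrite ler_wpM2r ?(ltW u0) // -[n%:R]/((n%:Z)%:~R) ler_int.
    by rewrite -addrA lerDl addr_ge0 ?mulr_ge0 ?ler0z //; lia.
  rewrite mulrAC => /le_trans; apply.
  apply: le_trans (ler_normD _ _) _; apply: le_trans (lerD (ler_normD _ _) (lexx _)) _.
  rewrite !normrM (gtr0_norm u0) (ger0_norm v0).
  have := eE n.+4; have := eE n.+3; have := eE n.+2.
  move: `|e n.+4| (normr_ge0 (e n.+3)) => p; move: `|e n.+3| => q.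
  move: `|e n.+2| (normr_ge0 (e n.+2)) => r; nra.
apply/eqP/negPn/negP => d0; have {}d0 : 0 < `|d| by rewrite normr_gt0.
have := bnd (Num.bound (3 * E / `|d|)); rewrite -ler_pdivlMr //.
apply/negP; rewrite -ltNge; apply: archi_boundP.
by rewrite divr_ge0 ?(ltW d0) // mulr_ge0 // (le_trans _ (eE 0)).
Qed.

(** The sequences A - x C and B - y C are forms vanishing at (x, y), hence bounded. They depend on
    the digits and on x, y only, so being bounded they vanish at (x', y') too. *)
Lemma mcf_uniq (R : realType) (x y x' y' : R) a b :
  is_mcf x y a b -> is_mcf x' y' a b -> x = x' /\ y = y'.
Proof.
move=> H H'.
have close (p q r : int) (s : R) :
    let f := fun n => (mcf_seq a b p q r n)%:~R - s * (mcf_seq a b 0 0 1 n)%:~R in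
    f 2%N * x + f 1%N * y + f 0%N = 0 -> f 2%N * x' + f 1%N * y' + f 0%N = 0.
  move=> f; have fr : digit_rec a b f.
    by move=> n; rewrite /f !mcf_seqS !intrD !intrM; ring.
  by case/(form_bounded H fr) => E _ /(form_bounded_eq0 H' fr).
have := close 1 0 0 x; have := close 0 1 0 y.
rewrite /mcf_seq !mulr1 !mulr0 !subr0 !mul0r !mul1r !sub0r ?add0r ?addr0.
by move=> /(_ (subrr _))/subr0_eq -> /(_ (subrr _))/subr0_eq ->.
Qed.

Lemma jacobi_periodic (R : realType) (x y : R) a b k h : is_mcf x y a b ->
  (forall n, (k <= n)%N -> a (n + h)%N = a n) ->
  (forall n, (k <= n)%N -> b (n + h)%N = b n) ->
  jacobi x y (h + k) = jacobi x y k.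
Proof.
move=> H pa pb.
have H1 := is_mcf_shift k H; have := is_mcf_shift (h + k) H.
have -> : (fun n => a (n + (h + k))%N) = (fun n => a (n + k)%N).
  by apply/funext => n; rewrite (addnC h) addnA pa ?leq_addl.
have -> : (fun n => b (n + (h + k))%N) = (fun n => b (n + k)%N).
  by apply/funext => n; rewrite (addnC h) addnA pb ?leq_addl.
by move=> /mcf_uniq /(_ H1) [E1 E2]; apply/eqP; rewrite -pair_eqE /= E1 E2 !eqxx.
Qed.

(** * Eigenvectors of rational 3 x 3 matrices *)

Lemma horner_mx_eigenvec (F L : fieldType) (f : {rmorphism F -> L}) n
    (N : 'M[F]_n.+1) (v : 'cV[L]_n.+1) (l : L) (q : {poly F}) :
  map_mx f N *m v = l *: v ->
  map_mx f (horner_mx N q) *m v = (map_poly f q).[l] *: v.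
Proof.
move=> Nv; elim/poly_ind: q => [|q c IHq].
  by rewrite !rmorph0 mul0mx horner0 scale0r.
rewrite !rmorphD !rmorphM /= horner_mx_X horner_mx_C map_polyX map_polyC.
rewrite map_scalar_mx mulmxDl -mulmxA Nv -scalemxAr IHq.
by rewrite mul_scalar_mx hornerMXaddC scalerA mulrC scalerDl.
Qed.

(* A left eigenvector w of N over F pairs nontrivially with v, so that l would be
   in F. *)
Lemma char_poly3_irreducible (F L : fieldType) (f : {rmorphism F -> L})
    (N : 'M[F]_3) (v : 'cV[L]_3) (l : L) :
  map_mx f N *m v = l *: v -> (forall w : 'rV_3, map_mx f w *m v = 0 -> w = 0) ->
  (forall r, l <> f r) ->
  irreducible_poly (char_poly N) /\ root (map_poly f (char_poly N)) l.
Proof.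
move=> Nv indep lN; split.
  apply: cubic_irreducible => [|r]; first by rewrite size_char_poly.
  rewrite -eigenvalue_root_char; apply/negP => /eigenvalueP [w wN].
  case/eqP; apply: indep.
  have := congr1 (fun u => map_mx f u *m v) wN.
  rewrite map_mxM map_mxZ -mulmxA Nv -scalemxAr -scalemxAl.
  move=> /eqP; rewrite -subr_eq0 -scalerBl scaler_eq0 => /orP[|/eqP //].
  by rewrite subr_eq0 => /eqP /lN.
have := horner_mx_eigenvec (char_poly N) Nv.
rewrite Cayley_Hamilton map_mx0 mul0mx => /esym/eqP.
rewrite scaler_eq0 => /orP[//|/eqP v0].
have /rowP/(_ 0) : const_mx 1 = 0 :> 'rV[F]_3 by apply: indep; rewrite v0 mulmx0.
by rewrite !mxE => /eqP; rewrite oner_eq0.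
Qed.

(** A dependence between w, w N, w N^2 is a nonzero q of degree at most 2 with w q(N) = 0. It is
    coprime to the irreducible characteristic polynomial, so q(l) is nonzero, and q(l) w v = w q(N)
    v = 0 forces w v = 0. *)
Lemma krylov_det_neq0 (F L : fieldType) (f : {rmorphism F -> L})
    (N : 'M[F]_3) (v : 'cV[L]_3) (l : L) (w : 'rV[F]_3) :
  map_mx f N *m v = l *: v -> (forall w : 'rV_3, map_mx f w *m v = 0 -> w = 0) ->
  (forall r, l <> f r) -> w != 0 -> \det (\matrix_(i < 3) (w *m N ^+ i)) != 0.
Proof.
move=> Nv indep lN w0; apply/negP => /det0P [s s0 sK].
have [irr rl] := char_poly3_irreducible Nv indep lN.
have ws : w *m horner_mx N (rVpoly s) = 0.
  rewrite -[RHS]sK [RHS]mulmx_sum_row /rVpoly poly_def (linear_sum (horner_mx N)).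
  rewrite mulmx_sumr; apply: eq_bigr => i _.
  by rewrite rowK valK linearZ /= rmorphXn /= horner_mx_X scalemxAr.
have q0 : rVpoly s != 0 by apply: contra s0 => /eqP q0; rewrite -(rVpolyK s) q0 linear0.
have : (map_poly f (rVpoly s)).[l] != 0.
  apply: coprimep_root rl; rewrite coprimep_map qpoly.irreducible_poly_coprime //.
  apply/negP => /(dvdp_leq q0); rewrite size_char_poly leqNgt ltnS.
  by rewrite (leq_trans (size_poly _ _)).
apply/negP/negPn.
have := horner_mx_eigenvec (rVpoly s) Nv => /(congr1 (mulmx (map_mx f w))).
rewrite mulmxA -map_mxM ws map_mx0 mul0mx -scalemxAr => /esym/eqP.
rewrite scaler_eq0 => /orP[//|/eqP/indep wv].
by rewrite wv eqxx in w0.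
Qed.

(** * Explicit 3 x 3 matrices *)

Definition row3 (S : nmodType) (x y z : S) : 'rV[S]_3 :=
  \row_j [:: x; y; z]`_j.

Definition mx3 (S : nmodType) (a b c d e f g h k : S) : 'M[S]_3 :=
  \matrix_(i, j) (nth [::] [:: [:: a; b; c]; [:: d; e; f]; [:: g; h; k]] i)`_j.

Lemma det_mx3 (S : comPzRingType) (a b c d e f g h k : S) :
  \det (mx3 a b c d e f g h k) =
    a * (e * k - f * h) - b * (d * k - f * g) + c * (d * h - e * g).
Proof.
rewrite (expand_det_row _ ord0) !big_ord_recl big_ord0 /cofactor.
do 3 rewrite (expand_det_row _ ord0) !big_ord_recl big_ord0 /cofactor !det_mx11.
rewrite !mxE /= /bump /=; ring.
Qed.

Lemma row3_mulmx (S : comPzRingType) (x y z a b c d e f g h k : S) :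
  row3 x y z *m mx3 a b c d e f g h k =
  row3 (x * a + y * d + z * g) (x * b + y * e + z * h) (x * c + y * f + z * k).
Proof.
apply/rowP => -[[|[|[|//]]] ?]; rewrite !mxE !big_ord_recl big_ord0 !mxE /=; ring.
Qed.

Lemma rows_mx3 (S : nmodType) (r : 'I_3 -> 'rV[S]_3) (a b c d e f g h k : S) :
  r ord0 = row3 a b c -> r (lift ord0 ord0) = row3 d e f ->
  r (lift ord0 (lift ord0 ord0)) = row3 g h k ->
  \matrix_i r i = mx3 a b c d e f g h k.
Proof.
move=> E0 E1 E2; apply/row_matrixP => i; rewrite rowK.
have -> : row i (mx3 a b c d e f g h k) = \row_j
  (nth [::] [:: [:: a; b; c]; [:: d; e; f]; [:: g; h; k]] i)`_j.
  by apply/rowP => j; rewrite !mxE.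
case: i => -[|[|[|//]]] lti /=.
- by rewrite -/(row3 a b c) -E0; congr r; apply/val_inj.
- by rewrite -/(row3 d e f) -E1; congr r; apply/val_inj.
- by rewrite -/(row3 g h k) -E2; congr r; apply/val_inj.
Qed.

Lemma rat_lin_indep (R : realType) (x y : R) (p q r : rat) :
  (forall p q r : int, p%:~R * x + q%:~R * y + r%:~R = 0 ->
    [/\ p = 0, q = 0 & r = 0]) ->
  ratr p * x + ratr q * y + ratr r = 0 -> [/\ p = 0, q = 0 & r = 0].
Proof.
move=> indep; pose d z := (denq z)%:~R : R.
have d0 z : d z != 0 by rewrite intr_eq0 denq_neq0.
have dE z : ratr z = (numq z)%:~R / d z by rewrite /ratr.
have n0 z : numq z = 0 -> z = 0 by move=> e; rewrite -[z]divq_num_den e mul0r.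
rewrite !dE => E.
have [] := indep (numq p * denq q * denq r) (numq q * denq p * denq r)
  (numq r * denq p * denq q).
  rewrite !intrM -!/(d _).
  have -> : (numq p)%:~R * d q * d r * x + (numq q)%:~R * d p * d r * y
    + (numq r)%:~R * d p * d q = d p * d q * d r *
    ((numq p)%:~R / d p * x + (numq q)%:~R / d q * y + (numq r)%:~R / d r).
    by field; rewrite !d0.
  by rewrite E mulr0.
move=> /eqP + /eqP + /eqP; rewrite !mulf_eq0 !(negPf (denq_neq0 _)) !orbF.
by move=> /eqP/n0 -> /eqP/n0 -> /eqP/n0 ->.
Qed.

(** * Integer cubics without rational roots and their heights *)

Lemma map_poly_ratr_int (R : numFieldType) (P : {poly int}) :
  map_poly (ratr : rat -> R) (map_poly intr P) = map_poly intr P.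
Proof. by rewrite -map_poly_comp; apply: eq_map_poly => z /=; rewrite ratr_int. Qed.

Lemma cubic_of_poly (R : realType) (P : {poly int}) (x : R) :
  size P = 4 -> (forall r : rat, ~~ root (map_poly intr P) r) ->
  root (map_poly intr P) x -> cubic_irrational x.
Proof.
move=> P4 noroot Px; pose p := map_poly intr P : {poly rat}.
have p4 : size p = 4 by rewrite size_rat_int_poly.
have c0 : (lead_coef p)^-1 != 0 by rewrite invr_eq0 lead_coef_eq0 -size_poly_gt0 p4.
exists ((lead_coef p)^-1 *: p); split.
- by rewrite monicE lead_coefZ mulVf // -invr_eq0.
- apply: cubic_irreducible => [|r]; first by rewrite size_scale // p4.
  by rewrite rootZ.
- by rewrite map_polyZ /= rootZ ?fmorph_eq0 // map_poly_ratr_int.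
- by rewrite size_scale.
Qed.

(* Being irreducible over the rationals, P divides the minimal polynomial, hence
   its primitive part is the minimal polynomial over the integers up to sign. *)
Lemma minpolyZ_coef_le (R : realType) (P : {poly int}) (x : R) i :
  size P = 4 -> (forall r : rat, ~~ root (map_poly intr P) r) ->
  root (map_poly intr P) x -> `|(minpolyZ x)`_i| <= `|P`_i|.
Proof.
(* The default value 0 of [xget] satisfies the bound trivially. *)
move=> P4 noroot Px; rewrite /minpolyZ; case: xgetP; last by rewrite coef0 normr0.
move=> Q _ [[Q0 _ irrQ] Qx].
have P0 : P != 0 by rewrite -size_poly_gt0 P4.
have irrP : irreducible_poly (map_poly intr P : {poly rat}).
  by apply: cubic_irreducible => [|r]; rewrite ?size_rat_int_poly ?P4.
have : P %| Q.
  rewrite -dvdp_rat_int; apply: contraT.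
  rewrite -qpoly.irreducible_poly_coprime // -(coprimep_map (ratr : rat -> R)).
  rewrite !map_poly_ratr_int => /coprimep_root /(_ Px).
  by rewrite (rootP Qx) eqxx.
case/dvdpP_int => r EQ.
have sP : size (zprimitive P) = 4 by rewrite size_zprimitive.
have [|] := irrQ _ _ EQ; first by rewrite poly_unitE sP.
rewrite poly_unitE => /andP[/size_poly1P [c c0 rc]]; rewrite rc coefC eqxx /= => cu.
have cn : `|c| = 1 by move: cu; rewrite unfold_in /= => /orP[] /eqP ->.
rewrite EQ rc mulrC mul_polyC coefZ normrM cn mul1r [in leRHS](zpolyEprim P) coefZ.
rewrite normrM ler_peMl // -gtz0_ge1 normr_gt0.
by rewrite zcontents_eq0.
Qed.

Lemma naive_height_le (R : realType) (x : R) (B : int) : 0 <= B ->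
  (forall i, `|(minpolyZ x)`_i| <= B) -> (naive_height x)%:Z <= B.
Proof.
move=> B0 le; rewrite -(gez0_abs B0) lez_nat; apply/bigmax_leqP => i _.
by rewrite -lez_nat (gez0_abs B0) abszE; apply: le.
Qed.

(* The eigenvector equations give y (n32 x - n12) = Q(x) with Q quadratic, and
   eliminating y from the second one leaves this cubic for x; up to sign it is the
   determinant of w, w N, w N^2 for w = (1, 0, -x). *)
Definition elim_poly (n11 n12 n13 n21 n22 n23 n31 n32 n33 : int) : {poly int} :=
  let d := n11 - n33 in let e := n33 - n22 in
  Poly [:: n32 * n13 ^+ 2 - e * n13 * n12 - n23 * n12 ^+ 2;
    2 * n32 * d * n13 - n31 * n13 * n12 + e * (n13 * n32 - d * n12)
      - n21 * n12 ^+ 2 + 2 * n23 * n32 * n12;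
    n32 * (d ^+ 2 - 2 * n31 * n13) + n31 * (n13 * n32 - d * n12)
      + e * (d * n32 + n31 * n12) + 2 * n21 * n32 * n12 - n23 * n32 ^+ 2;
    - 2 * n32 * n31 * d + n31 * (d * n32 + n31 * n12) - e * n31 * n32
      - n21 * n32 ^+ 2].

(** The right-hand side is the second eigenvector equation with y = Q / L, multiplied by L^2; its
    terms of degree 4 cancel. *)
Lemma elim_polyE (S : comNzRingType)
    (n11 n12 n13 n21 n22 n23 n31 n32 n33 : int) (x : S) :
  let Q := - n31%:~R * x ^+ 2 + (n11 - n33)%:~R * x + n13%:~R in
  let L := n32%:~R * x - n12%:~R in
  (map_poly intr (elim_poly n11 n12 n13 n21 n22 n23 n31 n32 n33)).[x] =
  n32%:~R * Q ^+ 2 + (n31%:~R * x + (n33 - n22)%:~R) * Q * L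
    - (n21%:~R * x + n23%:~R) * L ^+ 2.
Proof. by move=> Q L; rewrite /elim_poly map_Poly horner_Poly /Q /L /=; ring. Qed.

(** With the differences d and e at most 2 B, the triangle inequality gives the factors 4, 14, 18
    and 10 for degrees 0 to 3. *)
Lemma elim_poly_coef_le (n11 n12 n13 n21 n22 n23 n31 n32 n33 B : int) i :
  all (fun n => `|n| <= B) [:: n11; n12; n13; n21; n22; n23; n31; n32; n33] ->
  `|(elim_poly n11 n12 n13 n21 n22 n23 n31 n32 n33)`_i| <= 18 * B ^+ 3.
Proof.
have MB (p q s t : int) : `|p| <= s -> `|q| <= t -> `|p * q| <= s * t.
  by move=> ? ?; rewrite normrM ler_pM.
have DB (p q s t : int) : `|p| <= s -> `|q| <= t -> `|p + q| <= s + t by lia.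
have NB (p s : int) : `|p| <= s -> `|- p| <= s by rewrite normrN.
have KB : `|2 : int| <= 2 by [].
move=> /= /and5P [b1 b2 b3 b4 /and5P [b5 b6 b7 b8 /andP [b9 _]]].
have B0 : 0 <= B by lia.
have B3 : 0 <= B ^+ 3 by rewrite exprn_ge0.
rewrite coef_Poly; case: i => [|[|[|[|i]]]] /=; last first.
  by rewrite nth_nil normr0 mulr_ge0.
all: apply: le_trans; first (rewrite ?expr2;
  repeat match goal with
    | |- is_true (`|@Algebra.opp _ _| <= _) => eapply NB
    | |- is_true (`|@GRing.mul _ _ _| <= _) => eapply MB
    | |- is_true (`|@Algebra.add _ _ _| <= _) => eapply DB
    | |- _ => eassumption
    end).
all: clear -B3.
all: lia.
Qed.

(** For a nonzero, this is - a^3 P(- c / a) with P the elimination cubic: a = 0 isolates the leading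
    coefficient, a = 1 tests the root - c. *)
Lemma elim_poly_det (S : comNzRingType)
    (n11 n12 n13 n21 n22 n23 n31 n32 n33 : int) (a c : S) :
  let q (z : int) : S := z%:~R in
  let N := mx3 (q n11) (q n12) (q n13) (q n21) (q n22) (q n23)
    (q n31) (q n32) (q n33) in
  let p i := q (elim_poly n11 n12 n13 n21 n22 n23 n31 n32 n33)`_i in
  \det (\matrix_(i < 3) (row3 a 0 c *m N ^+ i)) =
    p 3%N * c ^+ 3 - p 2%N * a * c ^+ 2 + p 1%N * a ^+ 2 * c - p 0%N * a ^+ 3.
Proof.
move=> q N p; have E0 := mulmx1 (row3 a 0 c).
have E1 := etrans (congr1 (mulmx (row3 a 0 c)) (expr1 N))
  (row3_mulmx _ _ _ _ _ _ _ _ _ _ _ _).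
have E2 : row3 a 0 c *m N ^+ 2 = row3 a 0 c *m N *m N by rewrite expr2 mulmxA.
rewrite !row3_mulmx in E2.
rewrite (rows_mx3 (r := fun i => row3 a 0 c *m N ^+ i) E0 E1 E2) det_mx3.
rewrite /p /q !coef_Poly /=; ring.
Qed.

Lemma eigen_cubic (R : realType) (n11 n12 n13 n21 n22 n23 n31 n32 n33 : int)
    (x y l : R) (P := elim_poly n11 n12 n13 n21 n22 n23 n31 n32 n33) :
  l * x = n11%:~R * x + n12%:~R * y + n13%:~R ->
  l * y = n21%:~R * x + n22%:~R * y + n23%:~R ->
  l = n31%:~R * x + n32%:~R * y + n33%:~R ->
  (forall p q r : int, p%:~R * x + q%:~R * y + r%:~R = 0 ->
    [/\ p = 0, q = 0 & r = 0]) ->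
  (n31 != 0) || (n32 != 0) ->
  [/\ size P = 4, forall r : rat, ~~ root (map_poly intr P) r &
      root (map_poly intr P) x].
Proof.
move=> Ex Ey El indep n3.
pose q (z : int) : rat := z%:~R.
pose N := mx3 (q n11) (q n12) (q n13) (q n21) (q n22) (q n23)
  (q n31) (q n32) (q n33).
pose f : {rmorphism rat -> R} := ratr.
pose v : 'cV[R]_3 := (row3 x y 1)^T.
have Nv : map_mx f N *m v = l *: v.
  apply/colP => -[[|[|[|//]]] ?]; rewrite !mxE !big_ord_recl big_ord0 !mxE /=;
    by rewrite !ratr_int addr0 ?mulr1 addrA.
have vindep (w : 'rV_3) : map_mx f w *m v = 0 -> w = 0.
  move=> /matrixP/(_ 0 0); rewrite !mxE !big_ord_recl big_ord0 !mxE /=.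
  rewrite addr0 mulr1 addrA => /(rat_lin_indep indep) [w0 w1 w2].
  apply/rowP => -[[|[|[|//]]] ?]; rewrite mxE.
  - by rewrite -[RHS]w0; congr (w _ _); apply/val_inj.
  - by rewrite -[RHS]w1; congr (w _ _); apply/val_inj.
  - by rewrite -[RHS]w2; congr (w _ _); apply/val_inj.
(* A rational l would turn the third equation into a vanishing rational form, so that n31 = n32 =
   0. *)
have lN r : l <> f r.
  move=> lr; have [] := @rat_lin_indep R x y (q n31) (q n32) (q n33 - r) indep.
    by rewrite rmorphB !ratr_int /= -/(f r) -lr El; ring.
  by move=> /eqP + /eqP + _; rewrite !intr_eq0; case/orP: n3 => /negPf ->.
have K (w : 'rV[rat]_3) : w != 0 -> \det (\matrix_(i < 3) (w *m N ^+ i)) != 0.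
  exact: krylov_det_neq0 Nv vindep lN.
have Kx (a c : rat) : (a != 0) || (c != 0) -> let p i := (P`_i)%:~R in
    p 3%N * c ^+ 3 - p 2%N * a * c ^+ 2 + p 1%N * a ^+ 2 * c - p 0%N * a ^+ 3 != 0.
  move=> ac; have w0 : row3 a 0 c != 0.
    apply: contraTN ac => /eqP/rowP w0.
    by have := w0 0; have := w0 (inord 2); rewrite !mxE inordK //= => -> ->; rewrite eqxx.
  have := K _ w0.
  by have -> := elim_poly_det n11 n12 n13 n21 n22 n23 n31 n32 n33 a c.
have P3 : P`_3 != 0.
  have := Kx 0 1; rewrite oner_eq0 orbT => /(_ isT).
  by apply: contra => /eqP /= ->; apply/eqP; ring.
have PE (S : comNzRingType) (r : S) : (map_poly intr P).[r] =
    (P`_0)%:~R + (P`_1)%:~R * r + (P`_2)%:~R * r ^+ 2 + (P`_3)%:~R * r ^+ 3.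
  rewrite {1}/P /elim_poly map_Poly horner_Poly !coef_Poly /=; ring.
split.
- by rewrite /P /elim_poly (PolyK (c := 0)) //; move: P3; rewrite coef_Poly.
- move=> r; have := Kx 1 (- r); rewrite oner_eq0 => /(_ isT).
  by apply: contra => /rootP; rewrite PE => e; apply/eqP; rewrite -[RHS]oppr0 -e /=; ring.
- apply/rootP; rewrite elim_polyE.
  have -> : - n31%:~R * x ^+ 2 + (n11 - n33)%:~R * x + n13%:~R =
      y * (n32%:~R * x - n12%:~R) :> R.
    have -> : n13%:~R = l * x - n11%:~R * x - n12%:~R * y :> R by rewrite Ex; ring.
    by rewrite El; ring.
  transitivity ((n32%:~R * x - n12%:~R) ^+ 2 *
    ((n31%:~R * x + n32%:~R * y + n33%:~R) * y
      - (n21%:~R * x + n22%:~R * y + n23%:~R))); first by ring.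
  by rewrite -El Ey subrr mulr0.
Qed.

Lemma eigen_cubic_height (R : realType)
    (n11 n12 n13 n21 n22 n23 n31 n32 n33 : int) (x y l : R) :
  l * x = n11%:~R * x + n12%:~R * y + n13%:~R ->
  l * y = n21%:~R * x + n22%:~R * y + n23%:~R ->
  l = n31%:~R * x + n32%:~R * y + n33%:~R ->
  (forall p q r : int, p%:~R * x + q%:~R * y + r%:~R = 0 ->
    [/\ p = 0, q = 0 & r = 0]) ->
  (n31 != 0) || (n32 != 0) ->
  cubic_irrational x /\ (forall B : int,
    all (fun n => `|n| <= B) [:: n11; n12; n13; n21; n22; n23; n31; n32; n33] ->
    (naive_height x)%:Z <= 18 * B ^+ 3).
Proof.
move=> Ex Ey El indep n3.
have [P4 noroot Px] := eigen_cubic Ex Ey El indep n3.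
split=> [|B nB]; first exact: cubic_of_poly P4 noroot Px.
apply: naive_height_le => [|i].
  by apply: le_trans (elim_poly_coef_le 0 nB); apply: normr_ge0.
apply: le_trans (minpolyZ_coef_le i P4 noroot Px) _.
exact: elim_poly_coef_le.
Qed.

(** * The period matrix *)

(* The determinant with rows (u_(m+2), u_(m+1), u_m), (y_(n+2), y_(n+1), y_n) and
   (z_(n+2), z_(n+1), z_n); by Cramer's rule, the entries of N have this form. *)
Definition cramer (u : nat -> int) (m : nat) (y z : nat -> int) (n : nat) : int :=
  u m.+2 * (y n.+1 * z n - y n * z n.+1) - u m.+1 * (y n.+2 * z n - y n * z n.+2)
    + u m * (y n.+2 * z n.+1 - y n.+1 * z n.+2).

Lemma cramer_norm_le u m y z n (M : int) :
  (forall i, i \in [:: n; n.+1; n.+2] -> 0 <= y i <= M /\ 0 <= z i <= M) ->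
  (forall i, i \in [:: m; m.+1; m.+2] -> 0 <= u i <= M) ->
  `|cramer u m y z n| <= 3 * M ^+ 3.
Proof.
move=> yz um.
have prod p q : 0 <= p <= M -> 0 <= q <= M -> 0 <= p * q <= M ^+ 2.
  by move=> /andP[? ?] /andP[? ?]; rewrite mulr_ge0 // expr2 ler_pM.
have minor i j : i \in [:: n; n.+1; n.+2] -> j \in [:: n; n.+1; n.+2] ->
    `|y i * z j - y j * z i| <= M ^+ 2.
  move=> /yz[yi zi] /yz[yj zj].
  by have := prod _ _ yi zj; have := prod _ _ yj zi; lia.
have term i p : i \in [:: m; m.+1; m.+2] -> `|p| <= M ^+ 2 -> `|u i * p| <= M ^+ 3.
  by move=> /um/andP[u0 uM] pM; rewrite normrM exprS ler_pM // ger0_norm.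
have t1 := term m.+2 _ _ (minor n.+1 n _ _).
have t2 := term m.+1 _ _ (minor n.+2 n _ _).
have t3 := term m _ _ (minor n.+2 n.+1 _ _).
rewrite /cramer; move: t1 t2 t3; rewrite !inE !eqxx !orbT.
move=> /(_ isT isT isT) + /(_ isT isT isT) + /(_ isT isT isT).
move: (u m.+2 * _) (u m.+1 * _) (u m * _) => p q r; lia.
Qed.

(** Cramer's rule; multiplying the left-hand side by the determinant, which is 1, makes it a
    polynomial identity. *)
Lemma cramerE (S : comPzRingType) (A B C : nat -> int) u m n (s t r : S) :
  cramer A n B C n = 1 ->
  let form (f : nat -> int) i := (f i.+2)%:~R * s + (f i.+1)%:~R * t + (f i)%:~R * r in
  form u m = (cramer u m B C n)%:~R * form A n + (cramer u m C A n)%:~R * form B n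
    + (cramer u m A B n)%:~R * form C n.
Proof.
move=> d1 form; have {}d1 : (cramer A n B C n)%:~R = 1 :> S by rewrite d1.
by rewrite -[LHS]mul1r -[X in X * _ = _]d1 /form /cramer; ring.
Qed.

(** Each step of the recurrence is a column operation followed by a cyclic permutation of the three
    columns, which is even. *)
Lemma mcf_cramer1 a b n :
  cramer (mcf_seq a b 1 0 0) n (mcf_seq a b 0 1 0) (mcf_seq a b 0 0 1) n = 1.
Proof.
elim: n => // n IHn; rewrite -[RHS]IHn /cramer !mcf_seqS; ring.
Qed.

Lemma mcf_prod_homo (R : realType) (x y : R) a b : is_mcf x y a b ->
  (forall n, 0 < \prod_(i < n) (jacobi x y i.+1).1) /\
  {homo (fun n => \prod_(i < n) (jacobi x y i.+1).1) : m n / (m < n)%N >-> m < n}.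
Proof.
move=> H; have u1 n : 1 < (jacobi x y n.+1).1 by have [] := jacobi_next n H.
have p0 n : 0 < \prod_(i < n) (jacobi x y i.+1).1.
  by apply: prodr_gt0 => i _; apply: lt_trans (u1 i).
split=> //; apply: homo_ltn => [? ? ?|n]; first exact: lt_trans.
by rewrite big_ord_recr ltr_pMr.
Qed.

(** By [jacobi_form], the convergent matrices at k and h + k map the common vector (alpha_k, beta_k,
    1) to multiples of (x, y, 1). The quotient l of the two factors is the product of the alpha_i
    over one period, each of them above 1. *)
Lemma mcf_period_eigen (R : realType) (x y : R) a b k h
    (A := mcf_seq a b 1 0 0) (B := mcf_seq a b 0 1 0) (C := mcf_seq a b 0 0 1)
    (N := fun u y z => (cramer u (h + k) y z k)%:~R : R) :
  is_mcf x y a b -> jacobi x y (h + k) = jacobi x y k -> (0 < h)%N ->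
  exists2 l : R, 1 < l &
    [/\ l * x = N A B C * x + N A C A * y + N A A B,
        l * y = N B B C * x + N B C A * y + N B A B
      & l = N C B C * x + N C C A * y + N C A B].
Proof.
move=> H per h0; have [p0 pm] := mcf_prod_homo H.
pose p n := \prod_(i < n) (jacobi x y i.+1).1.
pose w (u : nat -> int) : R := (u 2%N)%:~R * x + (u 1%N)%:~R * y + (u 0%N)%:~R.
have wA : w A = x by rewrite /w [A 2%N]/1 [A 1%N]/0 [A 0%N]/0; ring.
have wB : w B = y by rewrite /w [B 2%N]/0 [B 1%N]/1 [B 0%N]/0; ring.
have wC : w C = 1 by rewrite /w [C 2%N]/0 [C 1%N]/0 [C 0%N]/1; ring.
have form (u : nat -> int) n : digit_rec a b (fun n => (u n)%:~R : R) ->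
    p n * w u = (u n.+2)%:~R * (jacobi x y n).1 + (u n.+1)%:~R * (jacobi x y n).2
      + (u n)%:~R * 1.
  by move=> Hu; rewrite mulr1 /p /w (jacobi_form n H Hu).
have pk0 : 0 < p k by exact: p0.
have pk : p k != 0 by rewrite gt_eqF.
exists (p (h + k)%N / p k).
  by rewrite ltr_pdivlMr // mul1r; apply: pm; rewrite -[ltnLHS]add0n ltn_add2r.
have rA := mcf_seq_rec R a b 1 0 0; have rB := mcf_seq_rec R a b 0 1 0.
have rC := mcf_seq_rec R a b 0 0 1.
have key u : digit_rec a b (fun n => (u n)%:~R : R) ->
    p (h + k)%N / p k * w u = N u B C * x + N u C A * y + N u A B.
  move=> Hu; rewrite mulrAC form // per.
  have -> := cramerE u (h + k) (jacobi x y k).1 (jacobi x y k).2 1 (mcf_cramer1 a b k).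
  by rewrite -!form // wA wB wC -/(N _ _ _) -/(N _ _ _) -/(N _ _ _); field.
by have := key _ rA; have := key _ rB; have := key _ rC; rewrite wA wB wC mulr1.
Qed.

(* Otherwise N would be the scalar matrix c with c = l > 1, whereas the two
   determinants are both 1 and N maps one matrix of convergents to the other. *)
Lemma mcf_period_not_scalar (R : realType) (x y : R) a b k h
    (A := mcf_seq a b 1 0 0) (B := mcf_seq a b 0 1 0) (C := mcf_seq a b 0 0 1) :
  is_mcf x y a b -> jacobi x y (h + k) = jacobi x y k -> (0 < h)%N ->
  (cramer C (h + k) B C k != 0) || (cramer C (h + k) C A k != 0).
Proof.
move=> H per h0; rewrite -negb_and; apply/negP => /andP[/eqP n31 /eqP n32].
have [l l1 []] := mcf_period_eigen H per h0; rewrite -/A -/B -/C n31 n32.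
set c := cramer C _ A B _ => Ex Ey El.
have {}El : l = c%:~R by rewrite El; ring.
have [e11 n12 n13] : [/\ cramer A (h + k) B C k - c = 0,
    cramer A (h + k) C A k = 0 & cramer A (h + k) A B k = 0].
  apply: (mcf_lin_indep H); rewrite intrD intrN -El mulrBl Ex; ring.
have [n21 e22 n23] : [/\ cramer B (h + k) B C k = 0,
    cramer B (h + k) C A k - c = 0 & cramer B (h + k) A B k = 0].
  apply: (mcf_lin_indep H); rewrite intrD intrN -El mulrBl Ey; ring.
have d1 := mcf_cramer1 a b k.
have scal (f : nat -> int) (M := fun y z => cramer f (h + k) y z k) :
    [/\ f (h + k).+2 = M B C * A k.+2 + M C A * B k.+2 + M A B * C k.+2,
        f (h + k).+1 = M B C * A k.+1 + M C A * B k.+1 + M A B * C k.+1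
      & f (h + k)%N = M B C * A k + M C A * B k + M A B * C k].
  (* Evaluating the form at the unit vectors yields its coefficients. *)
  have E := @cramerE int _ _ _ f (h + k) k _ _ _ d1.
  by split; [have := E 1 0 0 | have := E 0 1 0 | have := E 0 0 1];
    rewrite /= !intz !mulr1 !mulr0 ?addr0 ?add0r.
have [A2 A1 A0] := scal A; have [B2 B1 B0] := scal B; have [C2 C1 C0] := scal C.
have c3 : c ^+ 3 = 1.
  rewrite -[RHS](mcf_cramer1 a b (h + k)) -[LHS]mulr1 -[X in _ * X]d1.
  rewrite -/A -/B -/C [in RHS]/cramer A2 A1 A0 B2 B1 B0 C2 C1 C0.
  rewrite n31 n32 n12 n13 n21 n23 (subr0_eq e11) (subr0_eq e22) -/c /cramer; ring.
have c1 : 1 < c by rewrite -(ltr1z R) -El.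
by have := exprn_egt1 3 c1; rewrite c3.
Qed.

(** * Bounds on the unit square and conclusion *)

Lemma digits0_unit (R : realType) (x y : R) a b : is_mcf x y a b ->
  0 < x < 1 -> 0 < y < 1 -> a 0%N = 0 /\ b 0%N = 0.
Proof.
case=> _ -> -> /andP[x0 x1] /andP[y0 y1].
by split; apply: floor_def; rewrite ?(ltW x0) ?(ltW y0) /= ?add0r.
Qed.

(** As a_0 = b_0 = 0, A and B are at most C at indices 3, 4 and 5; later digits are nonnegative, so
    the recurrence preserves this. *)
Lemma mcf_seq_le (R : realType) (x y : R) a b i M
    (A := mcf_seq a b 1 0 0) (B := mcf_seq a b 0 1 0) (C := mcf_seq a b 0 0 1) :
  is_mcf x y a b -> a 0%N = 0 -> b 0%N = 0 -> (1 <= i <= M)%N -> (3 <= M)%N ->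
  [/\ 0 <= A i <= C M, 0 <= B i <= C M & 0 <= C i <= C M].
Proof.
move=> H a0 b0 /andP[i1 iM] M3.
have dig n := digits_ge n H.
have pos p q r : 0 <= p -> 0 <= q -> 0 <= r -> forall n,
    [/\ 0 <= mcf_seq a b p q r n, 0 <= mcf_seq a b p q r n.+1
      & 0 <= mcf_seq a b p q r n.+2].
  move=> p0 q0 r0; elim=> [|n [IH0 IH1 IH2]] //; split=> //.
  rewrite mcf_seqS; case: n IH0 IH1 IH2 => [|n] *; first by rewrite a0 b0; lia.
  by have [? ? _ _] := dig n; rewrite !addr_ge0 ?mulr_ge0 //; lia.
have Cmono m n : (2 < m)%N -> (m <= n)%N -> C m <= C n.
  case: m => [|[|[|m]]] // _.
  elim: n => // n IHn; rewrite leq_eqVlt => /orP[/eqP -> //|mn].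
  apply: le_trans (IHn mn) _; case: n mn {IHn} => [|[|[|n]]] // _.
  by have [] := mcf_seq_den_ge n H.
have CM : 1 <= C M.
  apply: le_trans (Cmono 3%N M isT M3).
  by rewrite [C 3%N]/(a 0%N * 0 + b 0%N * 0 + 1) a0 b0.
have le_C p q n : 
    mcf_seq a b p q 0 3 <= C 3%N -> mcf_seq a b p q 0 4 <= C 4%N ->
    mcf_seq a b p q 0 5 <= C 5%N ->
  [/\ mcf_seq a b p q 0 n.+3 <= C n.+3, mcf_seq a b p q 0 n.+4 <= C n.+4
    & mcf_seq a b p q 0 n.+1.+4 <= C n.+1.+4].
  move=> l3 l4 l5; elim: n => [|n [IH0 IH1 IH2]] //; split=> //.
  have [? ? _ _] := dig n.+2; rewrite /C 2!(mcf_seqS _ _ _ _ _ n.+3).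
  apply: lerD; last exact: IH0.
  by apply: lerD; apply: ler_wpM2l => //; lia.
have [a1 b1 ba1 e1] := dig 0%N; have [a2 b2 _ _] := dig 1%N.
have leA n : A n.+3 <= C n.+3.
  have [] // := le_C 1 0 n; rewrite /C /mcf_seq /= ?a0 ?b0; try lia.
  (* At index 5 the claim is a_2 b_1 + 1 <= a_2 a_1 + b_2, which for a_1 = b_1 is b_2 >= 1. *)
  have [/e1 ?|?] : a 1%N = b 1%N \/ b 1%N + 1 <= a 1%N by lia.
    by nia.
  by nia.
have leB n : B n.+3 <= C n.+3.
  by have [] // := le_C 0 1 n; rewrite /C /mcf_seq /= ?a0 ?b0; nia.
have [A0 _ _] := pos 1 0 0 isT isT isT i.
have [B0 _ _] := pos 0 1 0 isT isT isT i.
have [C0 _ _] := pos 0 0 1 isT isT isT i.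
rewrite A0 B0 C0 /=; case: i i1 iM {A0 B0 C0} => [|[|[|i]]] // _ iM.
- have [-> -> ->] : [/\ A 1%N = 0, B 1%N = 1 & C 1%N = 0] by []; split=> //; lia.
- have [-> -> ->] : [/\ A 2%N = 1, B 2%N = 0 & C 2%N = 0] by []; split=> //; lia.
by have Ci := Cmono i.+3 M isT iM; split=> //; apply: le_trans Ci.
Qed.

Theorem theorem16 (R : realType) (alpha0 beta0 : R) (a b : nat -> int)
    (k h : nat)
    (hmcf : is_mcf alpha0 beta0 a b)
    (hh : (1 <= h)%N)
    (hper_a : forall n : nat, (k <= n)%N -> a (n + h)%N = a n)
    (hper_b : forall n : nat, (k <= n)%N -> b (n + h)%N = b n) :
  (cubic_irrational alpha0 /\ cubic_irrational beta0) /\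
  (0 < alpha0 < 1 -> 0 < beta0 < 1 ->
   (naive_height alpha0)%:Z <= 3024%:Z * mcf_den a b (h + k - 1)%N ^+ 9 /\
   (naive_height beta0)%:Z <= 3024%:Z * mcf_den a b (h + k - 1)%N ^+ 9).
Proof.
have per := jacobi_periodic hmcf hper_a hper_b.
have [l l1 [Ea Eb El]] := mcf_period_eigen hmcf per hh.
have n3 := mcf_period_not_scalar hmcf per hh.
have indep p q r := @mcf_lin_indep R alpha0 beta0 a b p q r hmcf.
have [ca Ha] := eigen_cubic_height Ea Eb El indep n3.
(* Exchanging the first two rows and columns of N swaps the roles of [alpha0] and [beta0]. *)
have swap (s t u : R) : s + t + u = t + s + u by rewrite (addrC s).
rewrite swap in Ea; rewrite swap in Eb; rewrite swap in El.
have indep' p q r : p%:~R * beta0 + q%:~R * alpha0 + r%:~R = 0 ->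
    [/\ p = 0, q = 0 & r = 0] by rewrite swap => /indep[].
rewrite orbC in n3.
have [cb Hb] := eigen_cubic_height Eb Ea El indep' n3.
split=> // alpha01 beta01; have [a0 b0] := digits0_unit hmcf alpha01 beta01.
(* Pure periodicity would give a_h = a_0 = 0, but a_h >= 1. So the indices from k on lie in the
   range of [mcf_seq_le]. *)
have k0 : (0 < k)%N.
  rewrite lt0n; apply/eqP => k0; have := hper_a 0%N.
  rewrite k0 a0 => /(_ isT); have [+ _ _ _] := digits_ge h.-1 hmcf.
  by rewrite (prednK hh) add0n => + ah; rewrite ah.
(* After the shift by 3, C_(h+k-1) sits at the largest index occurring in N. *)
have -> : mcf_den a b (h + k - 1) = mcf_seq a b 0 0 1 (h + k).+2.
  by rewrite /mcf_den mcf_den3E; congr mcf_seq; lia.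
set M := mcf_seq _ _ _ _ _ _.
have bnd i : (0 < i <= (h + k).+2)%N ->
  [/\ 0 <= mcf_seq a b 1 0 0 i <= M, 0 <= mcf_seq a b 0 1 0 i <= M
    & 0 <= mcf_seq a b 0 0 1 i <= M].
  by move=> iM; apply: mcf_seq_le hmcf a0 b0 iM _; lia.
have N3 u y z : (forall i, (0 < i <= (h + k).+2)%N ->
    [/\ 0 <= u i <= M, 0 <= y i <= M & 0 <= z i <= M]) ->
    `|cramer u (h + k) y z k| <= 3 * M ^+ 3.
  move=> uyz; apply: cramer_norm_le => i; rewrite !inE => Hi.
    by have [] // := uyz i; move: Hi; lia.
  by have [] // := uyz i; move: Hi; lia.
have M0 : 0 <= M by have [] := bnd 1%N isT; lia.
(* Here 18 * 3^3 = 486, which is below 3024. *)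
have final (n : nat) : n%:Z <= 18 * (3 * M ^+ 3) ^+ 3 -> n%:Z <= 3024%:Z * M ^+ 9.
  move=> /le_trans; apply; rewrite exprMn -exprM mulrA ler_wpM2r ?exprn_ge0 //.
by split; apply: final; [apply: Ha | apply: Hb]; rewrite /= !N3 // => i /bnd[].
Qed.
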